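(* For all positive integers $\Delta$, $k$, and $q$, there exists a constant $c(\Delta,k,q)$ such that, if $H_1,\ldots,H_q$ are $k$-uniform hypergraphs each with $n$ vertices and maximum degree $\Delta$, then \[ r(H_1,\ldots,H_q) \le c(\Delta,k,q)\, n. \]
   Context: A hypergraph is $k$-uniform if every edge has exactly $k$ vertices. The degree of a vertex is the number of edges containing it, and the maximum degree is the largest degree of a vertex. $K_N^{(k)}$ denotes the complete $k$-uniform hypergraph on $N$ vertices. For $k$-uniform hypergraphs $H_1,\ldots,H_q$, the multicolour Ramsey number $r(H_1,\ldots,H_q)$ is the minimum $N$ such that in any $q$-colouring of the edges of $K_N^{(k)}$ with colours $1,\ldots,q$ there is, for some $i$ with $1\le i\le q$, a monochromatic copy of $H_i$ in colour $i$ (a copy is a not necessarily induced subhypergraph isomorphic to $H_i$). *)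

(* Defs.v *)
From HB Require Import structures.
From mathcomp Require Import all_boot.

Set Implicit Arguments.
Unset Strict Implicit.
Unset Printing Implicit Defensive.

Record hypergraph := Hypergraph {
  vertex : finType;
  edges : {set {set vertex}}
}.

Definition uniform (k : nat) (G : hypergraph) : Prop :=
  forall e : {set vertex G}, e \in edges G -> #|e| = k.

Definition degree (G : hypergraph) (v : vertex G) : nat :=
  #|[set e : {set vertex G} in edges G | v \in e]|.

Definition max_degree (G : hypergraph) : nat :=
  \max_(v : vertex G) degree v.

Definition isomorphic (G H : hypergraph) : Prop :=
  exists f : vertex G -> vertex H,
    bijective f /\ forall e : {set vertex G}, (f @: e \in edges H) = (e \in edges G).

(* The hypergraph with vertex set W and edge set F, carried by the subtype of
   W; meaningful when every member of F is contained in W. *)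
Definition subhypergraph (G : hypergraph)
    (W : {set vertex G}) (F : {set {set vertex G}}) : hypergraph :=
  @Hypergraph {x : vertex G | x \in W} [set e : {set {x : vertex G | x \in W}} | val @: e \in F].

(* F need not contain every edge of G inside W: copies are not necessarily
   induced. *)
Definition contains_copy (G H : hypergraph) : Prop :=
  exists (W : {set vertex G}) (F : {set {set vertex G}}),
    [/\ F \subset edges G,
        forall e : {set vertex G}, e \in F -> e \subset W
      & isomorphic (subhypergraph W F) H].

Definition complete (k N : nat) : hypergraph :=
  @Hypergraph 'I_N [set e : {set 'I_N} | #|e| == k].

Definition edge_colouring (q : nat) (G : hypergraph) : Type :=
  {e : {set vertex G} | e \in edges G} -> 'I_q.

Definition colour_class (q : nat) (G : hypergraph)
    (chi : edge_colouring q G) (i : 'I_q) : hypergraph :=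
  @Hypergraph (vertex G)
    [set val e | e : {e : {set vertex G} | e \in edges G} & chi e == i].

Definition ramsey_property (q k : nat) (H : 'I_q -> hypergraph) (N : nat) :
    Prop :=
  forall chi : edge_colouring q (complete k N),
    exists i : 'I_q, contains_copy (colour_class chi i) (H i).

(* The multicolour Ramsey number, as a relation; it is functional in r since
   least elements are unique. *)
Definition is_ramsey_number (q k : nat) (H : 'I_q -> hypergraph) (r : nat) :
    Prop :=
  ramsey_property k H r /\ (forall N, ramsey_property k H N -> r <= N).

Lemma contains_copyP (G H : hypergraph) :
  contains_copy G H <->
  exists f : vertex H -> vertex G,
    injective f /\ (forall e : {set vertex H}, e \in edges H -> f @: e \in edges G).
Proof.
split=> [[W [F [sFG sFW [f [[g fK gK] fE]]]]]|[f [f_inj fE]]].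
  exists (fun x => val (g x)); split.
    by move=> x y /val_inj /(can_inj gK).
  move=> e eH; apply: (subsetP sFG).
  have := fE (g @: e); rewrite -imset_comp (eq_imset (g := id)) // imset_id eH.
  by rewrite inE -imset_comp => <-.
pose W := f @: [set: vertex H].
exists W, [set f @: e | e : {set vertex H} in edges H].
have fW x : f x \in W by rewrite imset_f.
pose g x : {x | x \in W} := exist _ (f x) (fW x).
have g_inj : injective g by move=> x y /(congr1 val) /f_inj.
have g_bij : bijective g.
  apply: inj_card_bij => //.
  by rewrite card_sig (card_imset _ f_inj) cardsT.
split.
- by apply/subsetP => _ /imsetP[e eH ->]; apply: fE.
- by move=> _ /imsetP[e _ ->]; apply/subsetP => _ /imsetP[x _ ->].
- have [h gK hK] := g_bij; exists h; split; first by exists g.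
  move=> e; rewrite inE.
  have -> : val @: e = f @: (h @: e).
    by rewrite -imset_comp; apply: eq_imset => x /=; rewrite -{1}[x]hK.
  by rewrite (mem_imset _ _ (imset_inj f_inj)).
Qed.

(* Main.v *)
(* The proof chooses a random tuple [z] of [R] vertices of the host, where [R] is
   a Ramsey number for complete k-uniform hypergraphs, and treats the target part
   by part.  For a set [J] of positions call a set [S] of host vertices extendible
   (in a given colour) when every k-set of the form [S :|: z @: Y], [Y \subset J],
   has that colour.  By
   resampling the single coordinate [z a], a configuration of sets whose common
   link (with respect to the positions after [a]) has fewer than [#|V| / D] vertices
   is unlikely to have [z a] in that link; hence for a suitable [z] almost every
   configuration that stays extendible after adding [z a] has a large common link.
   Ramsey's theorem applied to [z] itself gives a monochromatic set [J] of
   positions and a colour.  The vertices of the target, coloured so that every edge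
   is rainbow, are assigned to positions of [J] and embedded greedily in
   increasing order, into common links; a conditional-expectation argument over the
   random completions of the neighbourhood of each unembedded vertex keeps the
   exceptional configurations out of reach, at the cost of linear host size. *)
Require Import Defs.
From mathcomp Require Import all_boot zify.
From Stdlib Require Import Classical_Prop.

Set Implicit Arguments.
Unset Strict Implicit.
Unset Printing Implicit Defensive.

(** * Ramsey's theorem for lists, and greedy colouring *)

(** Induction on [k]: a fixed head induces a colouring of the tails, so iterating yields a long list
    on which the colour depends only on the head ([head_hom]); among [q * L + 1] heads, [L] share a
    colour. *)
Lemma ramsey_list (k q L : nat) :
  exists R, forall (T : eqType) (s : seq T) (chi : seq T -> 'I_q),
    uniq s -> R <= size s ->
    exists (t : seq T) (c : 'I_q),
      [/\ subseq t s, size t = L &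
          forall u, subseq u t -> size u = k -> chi u = c].
Proof.
elim: k L => [|k IHk] L.
  exists L => T s chi _ sL; exists (take L s), (chi [::]); split.
  - exact: take_subseq.
  - by rewrite size_take_min; apply/minn_idPl.
  - by move=> u _ /size0nil ->.
have head_hom m : exists R, forall (T : eqType) (s : seq T) (chi : seq T -> 'I_q),
    uniq s -> R <= size s ->
    exists (t : seq T) (c : T -> 'I_q),
      [/\ subseq t s, size t = m &
          forall a u, subseq (a :: u) t -> size u = k -> chi (a :: u) = c a].
  elim: m => [|m [Rm IHm]].
    exists 0 => T s chi _ _; exists [::], (fun=> chi [::]); split=> //.
    exact: sub0seq.
  have [R1 HR1] := IHk Rm; exists R1.+1 => T [//|a s] chi /= /andP[_ us] sR.
  have [t1 [c1 [t1s t1R Hc1]]] := HR1 T s (fun u => chi (a :: u)) us sR.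
  have [|t2 [c2 [t2t1 t2m Hc2]]] := IHm T t1 chi (subseq_uniq t1s us).
    by rewrite t1R.
  exists (a :: t2), (fun x => if x == a then c1 else c2 x); split.
  - by rewrite /= eqxx (subseq_trans t2t1).
  - by rewrite /= t2m.
  - move=> b u /=; case: eqP => [->|_] ut uk; last exact: Hc2.
    by apply: Hc1 => //; apply: subseq_trans t2t1.
have [R HR] := head_hom (q * L).+1; exists R => T s chi us sR.
have [t [c [ts tm Hc]]] := HR T s chi us sR.
have [c0 Lc0] : exists c0, L <= count (fun x => c x == c0) t.
  have [c0 Lc0|small] := pickP (fun c0 => L <= count (fun x => c x == c0) t).
    by exists c0.
  have : size t <= q * L.
    rewrite -sum1_size (partition_big c predT) //=.
    rewrite -[q in q * L]card_ord -sum_nat_const.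
    apply: leq_sum => c0 _; by rewrite sum1_count ltnW // ltnNge small.
  by rewrite tm ltnn.
exists (take L (filter (fun x => c x == c0) t)), c0.
have sub_t : subseq (take L [seq x <- t | c x == c0]) [seq x <- t | c x == c0].
  exact: take_subseq.
split.
- by rewrite (subseq_trans sub_t) // (subseq_trans (filter_subseq _ _)).
- by rewrite size_take_min size_filter; apply/minn_idPl.
- case=> [//|a u] aut [uk]; have aut' := subseq_trans aut sub_t.
  rewrite Hc // ?(subseq_trans aut') ?filter_subseq //.
  have : a \in [seq x <- t | c x == c0] by apply: (mem_subseq aut'); rewrite mem_head.
  by rewrite mem_filter => /andP[/eqP].
Qed.

(** Later applied to [nbrs], so that vertices sharing an edge receive different positions. *)
Lemma greedy_colouring (T : finType) (e : rel T) (d : nat) :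
  symmetric e -> (forall x, #|[set y | e x y]| <= d) ->
  exists f : T -> 'I_d.+1, forall x y, x != y -> e x y -> f x != f y.
Proof.
move=> e_sym e_deg.
suff [f Hf] : exists f : T -> 'I_d.+1,
    {in enum T &, forall x y, x != y -> e x y -> f x != f y}.
  by exists f => x y; apply: Hf; rewrite mem_enum.
elim: (enum T) => [|x s [f Hf]]; first by exists (fun=> ord0) => x y.
have [c Hc] : exists c, c \notin f @: [set y | e x y].
  have [c Hc|all_c] := pickP [pred c | c \notin f @: [set y | e x y]].
    by exists c.
  have: #|'I_d.+1| <= d.
    apply: leq_trans (e_deg x); apply: leq_trans (leq_imset_card f _).
    by apply/subset_leq_card/subsetP => c _; move/negbFE: (all_c c).
  by rewrite card_ord ltnn.
have fresh y : e x y -> c != f y.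
  by move=> exy; apply: contraNneq Hc => ->; rewrite imset_f // inE.
exists (fun y => if y == x then c else f y) => y y'; rewrite !inE.
have [->|ne_yx] /= := eqVneq y x; have [->|ne_y'x] /= := eqVneq y' x.
- by rewrite eqxx.
- by move=> _ _ _; apply: fresh.
- by move=> _ _ _; rewrite e_sym eq_sym; apply: fresh.
- exact: Hf.
Qed.

(** * Counting tools: union bound, resampling, fibres *)

Lemma leq_card_bigcup (T I : finType) (P : pred I) (A : I -> {set T}) :
  #|\bigcup_(i | P i) A i| <= \sum_(i | P i) #|A i|.
Proof.
elim/big_rec2: _ => [|i m B _ le_Bm]; first by rewrite cards0.
by rewrite (leq_trans (leq_card_setU _ _)) // leq_add2l.
Qed.

Lemma union_bound (T I : finType) (A : I -> {set T}) :
  0 < #|T| -> (forall i, #|A i| * #|I|.+1 <= #|T|) ->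
  exists x, forall i, x \notin A i.
Proof.
move=> T0 HA.
have [x Hx] : exists x, x \notin \bigcup_i A i.
  have [x Hx|cover] := pickP [pred x | x \notin \bigcup_i A i]; first by exists x.
  have : #|T| * #|I|.+1 <= #|T| * #|I|; last by rewrite leq_pmul2l // ltnn.
  apply: (@leq_trans ((\sum_i #|A i|) * #|I|.+1)).
    rewrite leq_mul2r /=; apply: (@leq_trans #|\bigcup_i A i|).
      by apply/subset_leq_card/subsetP => x _; move/negbFE: (cover x).
    exact: leq_card_bigcup.
  by rewrite big_distrl /= mulnC -sum_nat_const; apply: leq_sum.
exists x => i; apply: contra Hx => xA; by apply/bigcupP; exists i.
Qed.

(* Exchanging [z a] with an independent uniform [v] is a measure-preserving
   involution of the pairs [(z, v)], and it leaves [F z] unchanged. *)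
Lemma resample_bound (I V : finType) (a : I)
    (F : {ffun I -> V} -> {set V}) (D : nat) :
  (forall z z' : {ffun I -> V},
     (forall b, b != a -> z b = z' b) -> F z = F z') ->
  #|[set z : {ffun I -> V} | (z a \in F z) && (#|F z| * D < #|V|)]| * D
    <= #|{ffun I -> V}|.
Proof.
move=> F_indep; set B := [set z | _].
have [V0|V0] := posnP #|V|.
  suff -> : B = set0 by rewrite cards0.
  by apply/setP => z; rewrite !inE V0 ltn0 andbF.
pose upd (z : {ffun I -> V}) v := [ffun b => if b == a then v else z b].
pose h (p : {ffun I -> V} * V) := (upd p.1 p.2, p.1 a).
have hK : involutive h.
  case=> z v; rewrite /h /= ffunE eqxx; congr pair.
  by apply/ffunP => b; rewrite !ffunE; case: eqP => // ->.
have F_upd z v : F (upd z v) = F z.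
  by apply: F_indep => b ba; rewrite ffunE (negPf ba).
(* The left side counts pairs [(z, v)] with [z \in B]; after the exchange the condition reads
   [v \in F z] with [F z] small. *)
have BV : #|B| * #|V| = \sum_z (if #|F z| * D < #|V| then #|F z| else 0).
  transitivity (\sum_(p : {ffun I -> V} * V) (p.1 \in B : nat)).
    rewrite -(pair_bigA _ (fun z v => (z \in B) : nat)) /=.
    rewrite -[#|B|]sum1_card big_distrl /= big_mkcond; apply: eq_bigr => z _.
    by rewrite sum_nat_const; case: (z \in B); rewrite ?mul1n ?muln1 ?muln0.
  rewrite (reindex_inj (inv_inj hK)) /=.
  rewrite -(pair_bigA _ (fun z v => (upd z v \in B) : nat)) /=.
  apply: eq_bigr => z _.
  under eq_bigr => v _ do rewrite inE F_upd ffunE eqxx.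
  case: ltnP => _; last by rewrite big1 // => v _; rewrite andbF.
  rewrite -[RHS]sum1_card [RHS]big_mkcond; apply: eq_bigr => v _.
  by rewrite andbT; case: (v \in F z).
rewrite -(leq_pmul2r V0) mulnAC BV big_distrl /= -sum_nat_const.
by apply: leq_sum => z _; case: ltnP => [/ltnW|].
Qed.

Lemma sum_fibre (T V : finType) (A : V -> {set T}) (B : {set T}) (f : T -> V) :
  (forall v y, y \in A v -> y \in B /\ f y = v) -> \sum_v #|A v| <= #|B|.
Proof.
move=> HA; rewrite -[#|B|]sum1_card (partition_big f predT) //=.
apply: leq_sum => v _; rewrite sum1_card; apply/subset_leq_card/subsetP => y /HA[yB <-].
by rewrite unfold_in yB eqxx.
Qed.

(** * Extendible sets, links and bad configurations *)

(** The size condition is left to [E], which in the application holds vacuously off the k-sets. *)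
Definition extends (R : nat) (V : finType) (E : {set V} -> bool)
    (z : {ffun 'I_R -> V}) (J : {set 'I_R}) (S : {set V}) : bool :=
  [forall Y : {set 'I_R}, (Y \subset J) ==> E (S :|: z @: Y)].

Definition link (R : nat) (V : finType) (E : {set V} -> bool)
    (z : {ffun 'I_R -> V}) (J : {set 'I_R}) (m : nat)
    (P : {set {set 'I_m}}) (y : {ffun 'I_m -> V}) : {set V} :=
  [set v | [forall A in P, extends E z J (v |: y @: A)]].

(* [P] is a set system on the index set ['I_m], so that a single finite list of
   patterns serves for target hypergraphs of every size. *)
Definition bad (R : nat) (V : finType) (E : {set V} -> bool)
    (z : {ffun 'I_R -> V}) (J : {set 'I_R}) (a : 'I_R) (D : nat) (m : nat)
    (P : {set {set 'I_m}}) (y : {ffun 'I_m -> V}) : bool :=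
  (z a \in link E z J P y) && (#|link E z J P y| * D < #|V|).

Lemma extendsS (R : nat) (V : finType) (E : {set V} -> bool)
    (z : {ffun 'I_R -> V}) (J J' : {set 'I_R}) (S : {set V}) :
  J \subset J' -> extends E z J' S -> extends E z J S.
Proof.
move=> sJ /forallP HS; apply/forallP => Y; apply/implyP => sY.
by have /implyP := HS Y; apply; apply: subset_trans sJ.
Qed.

Lemma link_agree (R : nat) (V : finType) (E : {set V} -> bool)
    (z z' : {ffun 'I_R -> V}) (J : {set 'I_R}) (m : nat)
    (P : {set {set 'I_m}}) (y : {ffun 'I_m -> V}) :
  {in J, z =1 z'} -> link E z J P y = link E z' J P y.
Proof.
move=> zz'; apply/setP => v; rewrite !inE; apply: eq_forallb => A; congr (_ ==> _).
apply: eq_forallb => Y; case: (boolP (Y \subset J)) => //= sY.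
by congr (E (_ :|: _)); apply: eq_in_imset => b /(subsetP sY); apply: zz'.
Qed.

(** Markov's inequality for the number of bad [y]. For each fixed [y], [resample_bound] applies
    because the link reads [z] only on [J], hence not at [a]. *)
Lemma few_bad (R : nat) (V : finType) (E : {set V} -> bool) (J : {set 'I_R})
    (a : 'I_R) (D C m : nat) (P : {set {set 'I_m}}) :
  a \notin J -> 0 < #|V| ->
  #|[set z : {ffun 'I_R -> V} |
      #|V| ^ m <= #|[set y | bad E z J a D P y]| * C]| * D
    <= #|{ffun 'I_R -> V}| * C.
Proof.
move=> aJ V0; set Z := [set z | _].
have Vm0 : 0 < #|V| ^ m by rewrite expn_gt0 V0.
have markov : #|Z| * #|V| ^ m <= (\sum_y #|[set z | bad E z J a D P y]|) * C.
  rewrite -sum_nat_const.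
  apply: (@leq_trans (\sum_(z in Z) #|[set y | bad E z J a D P y]| * C)).
    by apply: leq_sum => z; rewrite inE.
  rewrite -big_distrl /= leq_mul2r; apply/orP; right.
  apply: (@leq_trans (\sum_z #|[set y | bad E z J a D P y]|)).
    by rewrite big_mkcond; apply: leq_sum => z _; case: ifP.
  under eq_bigr => z _ do (rewrite -sum1_card; under eq_bigl => y do rewrite inE).
  under [X in _ <= X]eq_bigr => y _ do
    (rewrite -sum1_card; under eq_bigl => z do rewrite inE).
  by rewrite (exchange_big_dep predT).
have resampled : (\sum_y #|[set z | bad E z J a D P y]|) * D
    <= #|V| ^ m * #|{ffun 'I_R -> V}|.
  have -> : #|V| ^ m = #|{ffun 'I_m -> V}| by rewrite card_ffun card_ord.
  rewrite big_distrl /= -sum_nat_const.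
  apply: leq_sum => y _; apply: (@resample_bound _ _ a (fun z => link E z J P y)).
  move=> z z' zz'; apply: link_agree => b bJ; apply: zz'.
  by apply: contraNneq aJ => <-.
rewrite -(leq_pmul2r Vm0) mulnAC.
apply: leq_trans (leq_mul markov (leqnn D)) _.
by rewrite mulnAC [X in _ <= X]mulnAC leq_mul2r [X in _ <= X]mulnC resampled orbT.
Qed.

(** A union bound over all colours, positions, sets [J] and patterns, since [J] and the colour are
    extracted from [z] only afterwards. The number of events does not depend on [V], so neither does
    [K]. *)
Lemma good_tuple (q R M : nat) : exists K, forall (V : finType)
    (E : 'I_q -> {set V} -> bool) (Q D : nat -> nat),
  0 < #|V| -> (forall a m, m <= M -> Q a ^ m.+1 * K <= D a) ->
  exists z : {ffun 'I_R -> V},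
    forall i a (J : {set 'I_R}) m (P : {set {set 'I_m}}), a \notin J -> m <= M ->
      #|[set y | bad (E i) z J a (D a) P y]| * Q a ^ m.+1 < #|V| ^ m.
Proof.
pose event : finType :=
  ('I_q * 'I_R * {set 'I_R} * {m : 'I_M.+1 & {set {set 'I_m}}})%type.
exists #|event|.+1 => V E Q D V0 QD.
pose A (x : event) := let: (i, a, J, p) := x in
  [set z : {ffun 'I_R -> V} | (a \notin J) &&
     (#|V| ^ tag p <=
        #|[set y | bad (E i) z J a (D a) (tagged p) y]| * Q a ^ (tag p).+1)].
have [||z Hz] := @union_bound _ _ A.
- by rewrite card_ffun expn_gt0 V0.
- move=> [[[i a] J] p]; rewrite /A.
  have [aJ|aJ] := boolP (a \in J).
    set S := [set z | _]; suff -> : S = set0 by rewrite cards0.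
    by apply/setP => z; rewrite !inE.
  have p_le : tag p <= M by rewrite -ltnS.
  have [Q0|Q0] := posnP (Q a).
    set S := [set z | _]; suff -> : S = set0 by rewrite cards0.
    apply/setP => z; rewrite !inE Q0 exp0n // muln0 leqn0 expn_eq0.
    by rewrite (gtn_eqF V0) andbF.
  have C0 : 0 < Q a ^ (tag p).+1 by rewrite expn_gt0 Q0.
  rewrite -(leq_pmul2r C0); apply: leq_trans (few_bad (E i) (D a) _ (tagged p) aJ V0).
  by rewrite -mulnA leq_mul // mulnC QD.
exists z => i a J m P aJ; rewrite -ltnS => mM.
have := Hz (i, a, J, Tagged (fun m : 'I_M.+1 => {set {set 'I_m}})
                            (P : {set {set 'I_(Ordinal mM)}})).
by rewrite inE /= aJ -ltnNge.
Qed.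

(** * Greedy embedding along increasing positions *)

Section Embedding.

Variables (R M : nat) (V : finType) (E : {set V} -> bool).
Variables (z : {ffun 'I_R -> V}) (J : {set 'I_R}).
Variables (T : finType) (F : {set {set T}}) (pos : T -> 'I_R) (Q D : nat -> nat).

Definition nbrs (w : T) : {set T} :=
  [set u | [exists e in F, (w \in e) && (u \in e)]].

Definition back (w : T) : {set T} := [set u in nbrs w | pos u < pos w].

(** [t] is a [nat] rather than a position, to allow [(pos w).+1] and the final value [R]. *)
Definition from (t : nat) : {set 'I_R} := [set b in J | t <= b].

Definition pattern (w : T) : {set {set 'I_#|back w|}} :=
  [set [set j | (enum_val j : T) \in e] | e : {set T} in [set e in F | w \in e]].

Definition bad_at (w : T) (y : {ffun 'I_#|back w| -> V}) : bool :=
  bad E z (from (pos w).+1) (pos w) (D (pos w)) (pattern w) y.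

Definition bad_completions (w : T) (S : {set T}) (phi : T -> V) :
    {set {ffun 'I_#|back w| -> V}} :=
  [set y : {ffun 'I_#|back w| -> V} |
    [forall j, (enum_val j \in S) ==> (y j == phi (enum_val j))] && bad_at y].

(* The last clause says that a uniformly random completion of the back
   neighbourhood of an unembedded [w] is bad with probability less than
   [Q ^- r.+1], where [r] is the number of its unembedded vertices; for [r = 0]
   no bad completion is left. *)
Definition partial_embedding (S : {set T}) (phi : T -> V) : Prop :=
  [/\ {in S &, injective phi},
      forall u w, u \in S -> w \notin S -> pos u <= pos w,
      forall e (t : nat), e \in F -> {in e :&: S, forall u, pos u < t} ->
        extends E z (from t) (phi @: (e :&: S))
    & forall w, w \notin S ->
        #|bad_completions w S phi| * Q (pos w) ^ #|back w :\: S|.+1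
          < #|V| ^ #|back w :\: S|].

Hypothesis V_gt0 : 0 < #|V|.
Hypothesis posJ : forall w, pos w \in J.
Hypothesis pos_inj : forall e, e \in F -> {in e &, injective pos}.
Hypothesis clique : forall Y : {set 'I_R}, Y \subset J -> E (z @: Y).
Hypothesis nbrs_le : forall w, #|nbrs w| <= M.
Hypothesis Q_gt0 : forall a, 0 < Q a.
Hypothesis QD : forall a b, a < b -> 2 * M.+1 * D a <= Q b.
Hypothesis room : forall a : 'I_R, 2 * D a * #|T| <= #|V|.
Hypothesis good : forall w,
  #|[set y | @bad_at w y]| * Q (pos w) ^ #|back w|.+1 < #|V| ^ #|back w|.

Definition upd (phi : T -> V) (u : T) (v : V) : T -> V :=
  fun x => if x == u then v else phi x.

Lemma upd_imset (phi : T -> V) (u : T) (v : V) (A : {set T}) :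
  u \notin A -> upd phi u v @: A = phi @: A.
Proof.
by move=> uA; apply: eq_in_imset => x xA; rewrite /upd; case: eqP xA uA => // -> ->.
Qed.

(** Vertices positioned before [u] lie in [S] by minimality of [pos u]; conversely vertices of [S]
    come no later than [u], and strictly earlier within [e], where [pos] is injective. *)
Lemma back_edge (S : {set T}) (phi : T -> V) (u : T) (e : {set T}) :
  partial_embedding S phi -> u \notin S ->
  (forall w, w \notin S -> pos u <= pos w) -> e \in F -> u \in e ->
  e :&: S = e :&: back u.
Proof.
move=> [_ Sle _ _] uS umin eF ue; apply/setP => x; rewrite !inE.
have [xe|//] := boolP (x \in e); rewrite /=.
have -> /= : [exists e0 in F, (u \in e0) && (x \in e0)].
  by apply/existsP; exists e; rewrite eF ue xe.
apply/idP/idP => [xS|]; last first.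
  by apply: contraTT => /umin; rewrite -leqNgt.
rewrite ltn_neqAle Sle // andbT.
apply: contraNneq uS => /val_inj /(pos_inj eF xe ue) <-; exact: xS.
Qed.

Lemma pattern_imset (phi : T -> V) (u : T) (e : {set T}) :
  [ffun j : 'I_#|back u| => phi (enum_val j)] @: [set j | enum_val j \in e]
    = phi @: (e :&: back u).
Proof.
apply/setP => v; apply/imsetP/imsetP => [[j]|[x]].
  rewrite inE ffunE => je ->; exists (enum_val j) => //.
  by rewrite inE je enum_valP.
rewrite inE => /andP[xe xb] ->; exists (enum_rank_in xb x).
  by rewrite inE enum_rankK_in.
by rewrite ffunE enum_rankK_in.
Qed.

(** All back neighbours of [u] are embedded, so the last invariant with [r = 0] says that [phi]
    itself is not bad. The edge invariant at [t = pos u] puts [z (pos u)] in the link, which must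
    therefore be large. *)
Lemma candidates (S : {set T}) (phi : T -> V) (u : T) :
  partial_embedding S phi -> u \notin S ->
  (forall w, w \notin S -> pos u <= pos w) ->
  #|V| <= #|link E z (from (pos u).+1) (pattern u)
              [ffun j : 'I_#|back u| => phi (enum_val j)]| * D (pos u).
Proof.
move=> part uS umin; have [_ Sle ext few] := part.
set y := [ffun j => _].
have backS : back u :\: S = set0.
  apply/setP => x; rewrite !inE; apply/negbTE/negP => /and3P[xS _].
  by rewrite ltnNge umin.
have : y \notin bad_completions u S phi.
  have := few u uS; rewrite backS cards0 expn0 expn1 ltnS leqn0 muln_eq0.
  by rewrite (gtn_eqF (Q_gt0 _)) orbF cards_eq0 => /eqP->; rewrite inE.
rewrite inE negb_and => /orP[/negP[]|].
  by apply/forallP => j; rewrite ffunE eqxx implybT.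
rewrite /bad_at /bad negb_and -leqNgt => /orP[/negP[]|//].
rewrite inE; apply/forallP => A; apply/implyP => /imsetP[e].
rewrite inE => /andP[eF ue] ->; rewrite pattern_imset -(back_edge part uS umin eF ue).
apply/forallP => Y; apply/implyP => sY.
have lt_pos : {in e :&: S, forall x, pos x < pos u}.
  by move=> x; rewrite (back_edge part uS umin eF ue) !inE => /and3P[].
have /forallP/(_ (pos u |: Y)) := ext e (pos u) eF lt_pos.
rewrite imsetU1 setUCA setUA => /implyP; apply.
apply/subsetP => b; rewrite !inE => /orP[/eqP->|/(subsetP sY)].
  by rewrite posJ /=.
by rewrite inE => /andP[-> /ltnW].
Qed.

Definition spoiled (S : {set T}) (phi : T -> V) (u w : T) : {set V} :=
  [set v | #|V| ^ #|back w :\: (u |: S)| <=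
     #|bad_completions w (u |: S) (upd phi u v)|
       * Q (pos w) ^ #|back w :\: (u |: S)|.+1].

(** Bad completions split by their value at [u], and Markov's inequality over that value bounds the
    choices that break the last invariant at [w]; the exponent of [Q], one more than that of [#|V|],
    drops by one along with it. *)
Lemma spoiled_lt (S : {set T}) (phi : T -> V) (u w : T) :
  partial_embedding S phi -> u \notin S -> w \notin S -> u \in back w ->
  #|spoiled S phi u w| * Q (pos w) < #|V|.
Proof.
move=> [_ _ _ few] uS wS ub.
have cardS : #|back w :\: S| = #|back w :\: (u |: S)|.+1.
  by rewrite (cardsD1 u) inE ub uS setDDl setUC.
have := few w wS; rewrite cardS.
set r := #|back w :\: (u |: S)|; set C := #|bad_completions w S phi|.
have fibres : \sum_v #|bad_completions w (u |: S) (upd phi u v)| <= C.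
  pose at_u (y : {ffun 'I_#|back w| -> V}) := y (enum_rank_in ub u).
  rewrite /C; apply: (@sum_fibre _ _ _ _ at_u) => v y.
  rewrite !inE => /andP[/forallP agree ->]; rewrite andbT; split.
    apply/forallP => j; apply/implyP => jS; have := agree j.
    rewrite !inE jS orbT /= /upd; case: (eqVneq (enum_val j) u) => // ju.
    by rewrite ju (negPf uS) in jS.
  have := agree (enum_rank_in ub u).
  by rewrite /at_u enum_rankK_in // !inE eqxx /upd eqxx => /eqP.
have markov : #|spoiled S phi u w| * #|V| ^ r <= C * Q (pos w) ^ r.+1.
  apply: leq_trans (leq_mul fibres (leqnn _)).
  rewrite -sum_nat_const big_distrl /= big_mkcond; apply: leq_sum => v _.
  by rewrite inE; case: ifP.
move=> few_w; have Vr0 : 0 < #|V| ^ r by rewrite expn_gt0 V_gt0.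
rewrite -(ltn_pmul2r Vr0) mulnAC -expnS; apply: leq_ltn_trans few_w.
by rewrite [Q _ ^ r.+2]expnSr mulnA leq_mul2r markov orbT.
Qed.

(** The link has at least [#|V| / D (pos u)] elements. Used images fill less than half of this by
    [room], and values spoiling one of the at most [M] affected [w] fill at most half by [QD], so a
    choice remains. *)
Lemma extend_partial (S : {set T}) (phi : T -> V) (u : T) :
  partial_embedding S phi -> u \notin S ->
  (forall w, w \notin S -> pos u <= pos w) ->
  exists v, partial_embedding (u |: S) (upd phi u v).
Proof.
move=> part uS umin; have [phi_inj Sle ext few] := part.
pose W := [set w in ~: (u |: S) | u \in back w].
set N := link E z (from (pos u).+1) (pattern u) [ffun j => phi (enum_val j)].
have N_ge : #|V| <= #|N| * D (pos u) := candidates part uS umin.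
pose bads := \bigcup_(w in W) spoiled S phi u w.
have W_le : #|W| <= M.
  apply: leq_trans (nbrs_le u); apply/subset_leq_card/subsetP => w.
  rewrite inE => /andP[_]; rewrite !inE => /andP[/existsP[e /and3P[eF we ue]] _].
  by apply/existsP; exists e; rewrite eF ue.
have bads_le : #|bads| * (2 * D (pos u)) <= #|V|.
  have : #|bads| * (2 * M.+1 * D (pos u)) <= M * #|V|.
    apply: (@leq_trans (\sum_(w in W) #|V|)).
      2: by rewrite sum_nat_const leq_mul2r W_le orbT.
    apply: (@leq_trans
      ((\sum_(w in W) #|spoiled S phi u w|) * (2 * M.+1 * D (pos u)))).
      by rewrite leq_mul2r leq_card_bigcup orbT.
    rewrite big_distrl /=; apply: leq_sum => w.
    rewrite inE => /andP[]; rewrite !inE negb_or => /andP[_ wS] ub.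
    have ub' : u \in back w by rewrite !inE.
    apply: leq_trans (ltnW (spoiled_lt part uS wS ub')).
    by rewrite leq_mul2l QD ?orbT //; case/andP: ub.
  nia.
have used_lt : #|phi @: S| < #|T|.
  apply: leq_ltn_trans (leq_imset_card _ _) _.
  by have := max_card [in u |: S]; rewrite cardsU1 uS.
have [v vN v_new] : exists2 v, v \in N & v \notin phi @: S :|: bads.
  have [v /andP[]|none] := pickP [pred v | (v \in N) && (v \notin phi @: S :|: bads)].
    by exists v.
  have : #|N| <= #|phi @: S| + #|bads|.
    apply: leq_trans (leq_card_setU _ _); apply/subset_leq_card/subsetP => v vN.
    by have := none v; rewrite /= vN => /negbFE.
  have := room (pos u); nia.
move: v_new; rewrite inE negb_or => /andP[v_new v_ok].
exists v; split.
- move=> x x'; rewrite !inE /upd.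
  have [->|xu] := eqVneq x u; have [->|xu'] := eqVneq x' u => //=.
  + by move=> _ x'S vE; move: v_new; rewrite vE imset_f.
  + by move=> xS _ vE; move: v_new; rewrite -vE imset_f.
  + exact: phi_inj.
- move=> x w; rewrite !inE negb_or => /orP[/eqP->|xS] /andP[_ wS].
  + exact: umin.
  + exact: Sle.
- move=> e t eF lt_t; have [ue|ue] := boolP (u \in e); last first.
    have eE : e :&: (u |: S) = e :&: S.
      by apply/setP => x; rewrite !inE; case: eqP => // ->; rewrite (negPf ue).
    rewrite eE upd_imset ?inE ?(negPf ue) //; apply: ext => // x xeS.
    by apply: lt_t; rewrite eE.
  have eE : e :&: (u |: S) = u |: (e :&: S).
    by apply/setP => x; rewrite !inE; case: eqP => // ->; rewrite ue.
  have pos_t : pos u < t by apply: lt_t; rewrite !inE ue eqxx.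
  have sub_from : from t \subset from (pos u).+1.
    by apply/subsetP => b; rewrite !inE => /andP[-> /(leq_trans pos_t)].
  (* Positions from [t] on lie beyond [pos u], so it suffices that [v] is in the link. *)
  apply: (extendsS sub_from).
  rewrite eE imsetU1 upd_imset ?inE ?(negPf uS) ?andbF // /upd eqxx.
  rewrite (back_edge part uS umin eF ue) -pattern_imset.
  move: vN; rewrite inE => /forallP/(_ [set j | enum_val j \in e])/implyP; apply.
  by apply: imset_f; rewrite inE eF.
- move=> w; have [ub|ub] := boolP (u \in back w).
    move=> wS; have wW : w \in W by rewrite inE in_setC wS.
    rewrite ltnNge; apply: contra v_ok => v_sp.
    by apply/bigcupP; exists w; rewrite // inE.
  rewrite !inE negb_or => /andP[_ wS].
  have -> : back w :\: (u |: S) = back w :\: S.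
    apply/setP => x; rewrite !in_setD in_setU1.
    by have [->|//] := eqVneq x u; rewrite (negPf ub) !andbF.
  suff -> : bad_completions w (u |: S) (upd phi u v) = bad_completions w S phi.
    exact: few.
  apply/setP => y; rewrite !inE; congr (_ && _); apply: eq_forallb => j.
  have ju : enum_val j != u by apply: contraNneq ub => <-; apply: enum_valP.
  by rewrite !inE /upd (negPf ju).
Qed.

Lemma embedding : exists phi : T -> V,
  injective phi /\ forall e, e \in F -> E (phi @: e).
Proof.
have [v0 _] : exists v0 : V, v0 \in V by apply/card_gt0P.
have grow s : s <= #|T| ->
    exists (S : {set T}) (phi : T -> V), #|S| = s /\ partial_embedding S phi.
  elim: s => [_|s IHs sT].
    (* For the empty embedding the edge invariant is [clique] and the completion invariant follows
       from [good]. *)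
    exists set0, (fun=> v0); split; first exact: cards0.
    split=> [x|u w|e t eF _|w _]; rewrite ?inE //.
      apply/forallP => Y; apply/implyP => sY; rewrite setI0 imset0 set0U.
      apply: clique; apply: subset_trans sY _; apply/subsetP => b.
      by rewrite inE => /andP[].
    rewrite setD0; apply: leq_ltn_trans (good w).
    rewrite leq_mul2r; apply/orP; right; apply/subset_leq_card/subsetP => y.
    by rewrite !inE => /andP[].
  have [S [phi [cardS part]]] := IHs (ltnW sT).
  have [u0 u0S] : exists u0, u0 \in ~: S.
    by apply/card_gt0P; have := cardsC S; lia.
  rewrite inE in u0S.
  have [u /= uS umin] :=
    @arg_minnP T u0 [pred x | x \notin S] (fun x => pos x) u0S.
  have [v partv] := extend_partial part uS umin.
  by exists (u |: S), (upd phi u v); rewrite cardsU1 uS cardS.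
have [S [phi [cardS [phi_inj _ ext _]]]] := grow _ (leqnn _).
have ST : S = setT by apply/eqP; rewrite eqEcard subsetT cardsT cardS leqnn.
exists phi; split=> [x y|e eF]; first by apply: phi_inj; rewrite ST inE.
(* [R] exceeds every position, and [Y = set0] leaves just the image of [e]. *)
have /forallP/(_ set0) := ext e R eF (fun x _ => ltn_ord (pos x)).
by rewrite sub0set imset0 setU0 ST setIT.
Qed.

End Embedding.

(** * Choice of constants and assembly *)

(** [z] may repeat vertices, so a k-set [z @: Y] can come from more than k positions; a section
    picks exactly k of them, to which Ramsey's theorem applies. *)
Lemma imset_section (aT rT : finType) (f : aT -> rT) (Y : {set aT}) :
  exists A : {set aT}, [/\ A \subset Y, f @: A = f @: Y & #|A| = #|f @: Y|].
Proof.
pose r x := [pick x' in Y | f x' == f x].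
have r_f x x' : f x = f x' -> r x = r x'.
  by move=> ff; apply: eq_pick => y; rewrite ff.
pose A := [set x in Y | r x == Some x]; exists A.
have fA : f @: A = f @: Y.
  apply/setP => v; apply/imsetP/imsetP => [[x]|[x xY ->]].
    by rewrite inE => /andP[xY _] ->; exists x.
  have [x' rx] : exists x', r x = Some x'.
    rewrite /r; case: pickP => [x' _|/(_ x)]; first by exists x'.
    by rewrite xY eqxx.
  have /andP[x'Y /eqP fx'] : (x' \in Y) && (f x' == f x).
    by move: rx; rewrite /r; case: pickP => [y Hy [<-]|].
  by exists x'; rewrite // inE x'Y (r_f _ _ fx') rx /=.
split=> //; first by apply/subsetP => x; rewrite inE => /andP[].
rewrite -fA card_in_imset // => x x'; rewrite !inE => /andP[_ /eqP rx] /andP[_ /eqP rx'].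
by move/r_f; rewrite rx rx' => -[].
Qed.

Lemma least_exists (P : nat -> Prop) (N : nat) :
  P N -> exists r, (P r /\ forall m, P m -> r <= m) /\ r <= N.
Proof.
elim/ltn_ind: N => N IH PN.
have [[m [Pm mN]]|none] := classic (exists m, P m /\ m < N).
  by have [r [Hr rm]] := IH m mN Pm; exists r; split=> //; apply: leq_trans rm (ltnW mN).
exists N; do 2!split=> //; move=> m Pm; rewrite leqNgt; apply/negP => mN.
by apply: none; exists m.
Qed.

Lemma card_nbrs (G : hypergraph) (k : nat) (w : vertex G) :
  uniform k G -> #|nbrs (edges G) w| <= max_degree G * k.
Proof.
move=> unif; apply: (@leq_trans (degree w * k)); last first.
  by rewrite leq_mul2r (leq_bigmax w) orbT.
rewrite /degree -sum_nat_const.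
apply: (@leq_trans #|\bigcup_(e in [set e in edges G | w \in e]) e|).
  apply/subset_leq_card/subsetP => u; rewrite inE => /existsP[e /and3P[eG we ue]].
  by apply/bigcupP; exists e; rewrite // inE eG.
apply: leq_trans (leq_card_bigcup _ _) _.
by apply: leq_sum => e; rewrite inE => /andP[/unif->].
Qed.

(* The host has to be larger than the [D a = scale a.+1] by a factor linear in the
   number of vertices; [Q a = 2 * M.+1 * scale a] must dominate every earlier [D],
   and [D a] must dominate [Q a ^ m.+1 * K] for all [m <= M]. *)
Fixpoint scale (M K a : nat) : nat :=
  if a is a'.+1 then (2 * M.+1 * scale M K a') ^ M.+1 * K.+1 else 1.

Lemma scale_gt0 M K a : 0 < scale M K a.
Proof. by elim: a => //= a IH; rewrite muln_gt0 expn_gt0 !muln_gt0 IH. Qed.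

Lemma leq_scale M K a b : a <= b -> scale M K a <= scale M K b.
Proof.
elim: b => [|b IHb]; first by rewrite leqn0 => /eqP->.
rewrite leq_eqVlt ltnS => /predU1P[->//|/IHb/leq_trans]; apply.
apply: (@leq_trans (2 * M.+1 * scale M K b)); first by rewrite leq_pmull.
apply: (@leq_trans ((2 * M.+1 * scale M K b) ^ M.+1)); last by rewrite leq_pmulr.
by rewrite expnS leq_pmulr // expn_gt0 !muln_gt0 scale_gt0.
Qed.

Theorem theorem5 (Delta k q : nat) (hDelta : 0 < Delta) (hk : 0 < k) (hq : 0 < q) :
  exists c : nat,
    forall (n : nat) (H : 'I_q -> hypergraph),
      (forall i, uniform k (H i)) ->
      (forall i, #|vertex (H i)| = n) ->
      (forall i, max_degree (H i) = Delta) ->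
      exists r : nat, is_ramsey_number k H r /\ r <= c * n.
Proof.
set M := Delta * k.
(* One homogeneous position for each of the [M.+1] colours of the greedy colouring. *)
have [R HR] := ramsey_list k q M.+1.
have [K HK] := good_tuple q R M.
(* As positions are below [R], [scale M K R] dominates every [D a]; the factor 2 is that of
   [room]. *)
exists (2 * scale M K R) => n H unif cardH degH.
apply: (@least_exists (ramsey_property k H)) => chi.
set N := 2 * scale M K R * n in chi *.
pose i0 : 'I_q := Ordinal hq.
have n_gt0 : 0 < n.
  rewrite -(cardH i0) lt0n; apply: contraTneq hDelta => /card0_eq H0.
  by rewrite -(degH i0) /max_degree big1 // => v; have := H0 v.
have V_gt0 : 0 < #|'I_N| by rewrite card_ord !muln_gt0 scale_gt0.
(* Non-edges get the default colour [i0]; [E] consults [col] only on k-sets. *)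
pose col (S : {set 'I_N}) : 'I_q :=
  if (insub S : option {e | e \in edges (complete k N)}) is Some e then chi e else i0.
pose E (i : 'I_q) (S : {set 'I_N}) := (#|S| == k) ==> (col S == i).
pose Q a := 2 * M.+1 * scale M K a.
pose D a := scale M K a.+1.
have Q_gt0 a : 0 < Q a by rewrite !muln_gt0 scale_gt0.
have [|z Hz] := HK _ E Q D V_gt0.
  by move=> a m mM; rewrite /D /= leq_mul // leq_pexp2l.
have [||t [i [tR sizet Ht]]] := HR _ (enum 'I_R) (fun u => col (z @: [set x in u])).
- exact: enum_uniq.
- by rewrite size_enum_ord.
have ut : uniq t := (subseq_uniq tR (enum_uniq _)).
have col_edge (S : {set 'I_N}) : #|S| = k -> col S = i ->
    S \in edges (colour_class chi i).
  rewrite /col => cardS; case: insubP => [e _ eS chi_e|]; last by rewrite inE cardS eqxx.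
  by rewrite -eS; apply: imset_f; rewrite inE chi_e.
have deg x : #|nbrs (edges (H i)) x| <= M by rewrite /M -(degH i) card_nbrs.
have [||kappa Hkappa] :=
    @greedy_colouring (vertex (H i)) (fun x y => y \in nbrs (edges (H i)) x) M.
- by move=> x y; rewrite !inE; apply: eq_existsb => e; rewrite [(x \in e) && _]andbC.
- move=> x; apply: leq_trans (deg x).
  by apply/subset_leq_card/subsetP => y; rewrite inE.
(* Properness of [kappa] and distinctness of the entries of [t] make [pos] injective on each
   edge. *)
pose pos w := tnth (Tuple (introT eqP sizet)) (kappa w).
pose J := [set x in t].
have [||||||||phi [phi_inj phiE]] :=
    @embedding R M 'I_N (E i) z J _ (edges (H i)) pos Q D V_gt0.
- by move=> w; rewrite inE; apply: mem_tnth.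
- move=> e eH x y xe ye; have ut' : uniq (Tuple (introT eqP sizet)) by [].
  move/(tuple_uniqP _ ut') => kxy; apply/eqP; apply: contraT => xy.
  have /(Hkappa x y xy) : y \in nbrs (edges (H i)) x.
    by rewrite inE; apply/existsP; exists e; rewrite eH xe ye.
  by rewrite kxy eqxx.
- move=> Y sY; apply/implyP => /eqP cardY.
  have [A [sAY zA cardA]] := imset_section z Y.
  have setA : [set x in [seq x <- t | x \in A]] = A.
    apply/setP => x; rewrite inE mem_filter; case: (boolP (x \in A)) => //= xA.
    by have := subsetP (subset_trans sAY sY) x xA; rewrite inE.
  rewrite -zA -setA Ht ?filter_subseq //.
  rewrite -(card_uniqP (filter_uniq _ ut)) -cardY -cardA -{2}setA.
  by rewrite cardsE.
- exact: deg.
- exact: Q_gt0.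
- by move=> a b ab; rewrite /D /Q leq_mul // leq_scale.
- by move=> a; rewrite cardH card_ord /N leq_mul // leq_mul // leq_scale.
- move=> w; apply: Hz; first by rewrite !inE ltnn andbF.
  apply: leq_trans (deg w).
  by apply/subset_leq_card/subsetP => x; rewrite inE => /andP[].
exists i; apply/contains_copyP; exists phi; split=> // e eH.
have cardphi : #|phi @: e| = k by rewrite card_imset // (unif i).
apply: col_edge => //; have := phiE e eH.
by rewrite /E cardphi eqxx => /eqP.
Qed.
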